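(* Let $R$ be a ring and let $I$ be a nonempty subset of $R$. If $I$ is a right ideal of $R$, then $P_R(I)$ is a (two-sided) ideal of $R$.
   Context: Rings are associative, not necessarily commutative and not necessarily with identity. For a ring $R$, a nonempty subset $A\subseteq R$ and $a\in R$, put $S_R^a(A)=\{b\in R \mid aAb=(0)\}$, where $aAb=(0)$ means $acb=0$ for all $c\in A$. The source of primeness of the subset $A$ in $R$ is $P_R(A)=\bigcap_{a\in R}S_R^a(A)$. *)

(* Defs.v *)
From HB Require Import structures.
From mathcomp Require Import all_boot all_algebra.
From mathcomp Require Import classical_sets.

Set Implicit Arguments.
Unset Strict Implicit.
Unset Printing Implicit Defensive.

Import GRing.Theory.
Local Open Scope classical_set_scope.
Local Open Scope ring_scope.

(* MathComp's pzRingType and nzRingType always carry a unit.  Rings without a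
   postulated unit are built here as the join of an additive abelian group and
   a multiplicative semigroup; the product is therefore written (x * y)%g. *)
HB.mixin Record Zmodule_Semigroup_isRng R of GRing.Zmodule R & Semigroup R := {
  rmulDl : left_distributive (fun x y : R => (x * y)%g) (fun x y : R => x + y);
  rmulDr : right_distributive (fun x y : R => (x * y)%g) (fun x y : R => x + y)
}.

#[short(type="rngType")]
HB.structure Definition Rng :=
  {R of Zmodule_Semigroup_isRng R & GRing.Zmodule R & Semigroup R}.

(* zmod_closed and ring_quotient's idealr_closed are stated for boolean
   predicates (and idealr_closed moreover for proper ideals of unital rings),
   hence the following versions for classical sets. *)
Definition additive_subgroup (R : rngType) (I : set R) : Prop :=
  I 0 /\ forall x y : R, I x -> I y -> I (x - y).

Definition left_ideal (R : rngType) (I : set R) : Prop :=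
  additive_subgroup I /\ forall r x : R, I x -> I (r * x)%g.

Definition right_ideal (R : rngType) (I : set R) : Prop :=
  additive_subgroup I /\ forall r x : R, I x -> I (x * r)%g.

Definition two_sided_ideal (R : rngType) (I : set R) : Prop :=
  left_ideal I /\ right_ideal I.

(* S_R^a(A) *)
Definition primeness_annihilator (R : rngType) (a : R) (A : set R) : set R :=
  [set b | forall c : R, A c -> (a * c * b)%g = 0].

(* P_R(A) *)
Definition source_of_primeness (R : rngType) (A : set R) : set R :=
  \bigcap_(a in [set: R]) primeness_annihilator a A.

(* Main.v *)
Require Import Defs.
From mathcomp Require Import all_boot all_algebra.
From mathcomp Require Import classical_sets.

Local Open Scope classical_set_scope.

(** Each set [S_R^a(A)] is the right annihilator of the set [aA]: for any [A]
    it is a right ideal, since [(acb)r = 0] whenever [acb = 0].  If [A] absorbs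
    right multiplication, then a factor [r] put to the left of [b] can be moved
    into [A], because [ac(rb) = a(cr)b] with [cr] in [A]; so the annihilator is
    then also a left ideal.  Finally [P_R(A)] is an intersection of such
    annihilators, and ideals are stable under intersection. *)

Import GRing.Theory.
Local Open Scope ring_scope.

Lemma rmul0l (R : rngType) (x : R) : (0 * x)%g = 0 :> R.
Proof. by apply: (addIr (0 * x)%g); rewrite -rmulDl !add0r. Qed.

Lemma rmul0r (R : rngType) (x : R) : (x * 0)%g = 0 :> R.
Proof. by apply: (addIr (x * 0)%g); rewrite -rmulDr !add0r. Qed.

Lemma rmulBr (R : rngType) (x y z : R) :
  (x * (y - z))%g = (x * y)%g - (x * z)%g :> R.
Proof. by apply: (addIr (x * z)%g); rewrite -rmulDr !subrK. Qed.

Lemma right_ideal_primeness_annihilator (R : rngType) (a : R) (A : set R) :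
  right_ideal (primeness_annihilator a A).
Proof.
split; first split.
- by move=> c _; rewrite rmul0r.
- by move=> x y Sx Sy c Ac; rewrite rmulBr Sx // Sy // subrr.
- by move=> r x Sx c Ac; rewrite mulgA Sx // rmul0l.
Qed.

(** Only absorption on the left is at stake here.  It comes from
    reassociating [ac(rb)] as [a(cr)b] and using absorption by [A] for [cr]. *)
Lemma two_sided_ideal_primeness_annihilator (R : rngType) (a : R) (A : set R) :
  right_ideal A -> two_sided_ideal (primeness_annihilator a A).
Proof.
move=> [_ A_mulr].
have [S_add S_mulr] := right_ideal_primeness_annihilator R a A.
split; split=> // r x Sx c Ac.
by rewrite mulgA -(mulgA a) Sx //; apply: A_mulr.
Qed.

Lemma two_sided_ideal_bigcap (R : rngType) (T : Type) (D : set T)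
    (F : T -> set R) :
  (forall i, D i -> two_sided_ideal (F i)) ->
  two_sided_ideal (\bigcap_(i in D) F i).
Proof.
move=> idF.
have F_add : additive_subgroup (\bigcap_(i in D) F i).
  split=> [i Di | x y Fx Fy i Di]; have [[[F0 FB] _] _] := idF i Di => //.
  by apply: FB; [apply: Fx | apply: Fy].
split; split=> // r x Fx i Di; have [[_ F_mull] [_ F_mulr]] := idF i Di.
- by apply: F_mull; apply: Fx.
- by apply: F_mulr; apply: Fx.
Qed.

Theorem lemma2p14 (R : rngType) (I : set R) (hI0 : I !=set0)
    (hI : right_ideal I) :
  two_sided_ideal (source_of_primeness I).
Proof.
apply: two_sided_ideal_bigcap => a _.
exact: two_sided_ideal_primeness_annihilator.
Qed.
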